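(* Let $d\ge 1$. The maximality type of a transitive $d$-dimensional shift is either $0$ or $1$.
   Context: For a finite set $\mathcal{A}\subset\mathbb{Z}$, $\mathcal{A}^{\mathbb{Z}^d}$ carries the product topology and the shift action $\sigma^{\mathbf{u}}(x)_{\mathbf{v}}=x_{\mathbf{u}+\mathbf{v}}$. A $d$-dimensional shift is a nonempty compact set $X\subset\mathcal{A}^{\mathbb{Z}^d}$ with $\sigma^{\mathbf{u}}(X)\subset X$ for all $\mathbf{u}\in\mathbb{Z}^d$. $X$ is transitive if some $x\in X$ has orbit $\{\sigma^{\mathbf{u}}(x):\mathbf{u}\in\mathbb{Z}^d\}$ dense in $X$. A subsystem of $X$ is a nonempty closed shift-invariant subset of $X$; it is proper if it differs from $X$. A subsystem is maximal if it is proper and not contained in any other proper subsystem of $X$. The maximality type of $X$ is the cardinality of the set of its maximal subsystems. *)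

(* Defs.v *)
From HB Require Import structures.
From mathcomp Require Import all_boot all_order all_algebra finmap.
From mathcomp Require Import boolp classical_sets cardinality topology.

Set Implicit Arguments.
Unset Strict Implicit.
Unset Printing Implicit Defensive.

Import GRing.Theory.

Local Open Scope ring_scope.
Local Open Scope classical_set_scope.
Local Open Scope card_scope.

Notation lattice d := 'rV[int]_d.

Definition config (A : {fset int}) (d : nat) : topologicalType :=
  {ptws lattice d -> discrete_topology A}.

Section Shifts.
Variables (A : {fset int}) (d : nat).
Implicit Types (X Y Z : set (config A d)) (x : config A d) (u : lattice d).

Definition shift_map u x : config A d := fun v => x (u + v).

Definition shift_invariant X := forall u, shift_map u @` X `<=` X.

Definition is_shift X := [/\ X !=set0, compact X & shift_invariant X].

Definition shift_orbit x : set (config A d) := range (shift_map ^~ x).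

(* Density is relative to [X]. The library's [dense] on the type [subspace X]
   would not express this: there, points outside [X] are isolated. *)
Definition transitive_shift X := exists2 x, X x & X `<=` closure (shift_orbit x).

(* Closedness in the full space agrees with closedness in [X] when [X] is a
   shift, as a compact subset of a Hausdorff space is closed. *)
Definition subsystem X Y :=
  [/\ Y `<=` X, Y !=set0, closed Y & shift_invariant Y].

Definition proper_subsystem X Y := subsystem X Y /\ Y <> X.

Definition maximal_subsystem X Y :=
  proper_subsystem X Y /\
  forall Z, proper_subsystem X Z -> Y `<=` Z -> Z = Y.

(* Finite values suffice here: `I_n is the set of naturals below n. *)
Definition has_maximality_type X (n : nat) : Prop :=
  [set Y | maximal_subsystem X Y] #= `I_n.

End Shifts.

(* Main.v *)
Require Import Defs.
From mathcomp Require Import all_boot all_order all_algebra finmap.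
From mathcomp Require Import boolp classical_sets cardinality topology.

(** The union of two distinct maximal subsystems is a subsystem strictly larger
    than one of them, hence all of [X]. So one of the two contains a point with
    dense orbit and, being closed and invariant, equals [X]: a contradiction. *)

Local Open Scope classical_set_scope.

Lemma subsystemU (A : {fset int}) (d : nat) (X Y Z : set (config A d)) :
  subsystem X Y -> subsystem X Z -> subsystem X (Y `|` Z).
Proof.
move=> [YX [y Yy] cY iY] [ZX _ cZ iZ]; split.
- by rewrite subUset.
- by exists y; left.
- exact: closedU.
- by move=> u _ [w [Yw|Zw] <-]; [left; apply: (iY u)|right; apply: (iZ u)];
    exists w.
Qed.

(** Invariance keeps the whole orbit of [x] inside [Y], and closedness then keeps its closure there,
    which already covers [X]. *)
Lemma subsystem_dense_orbit (A : {fset int}) (d : nat)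
    (X Y : set (config A d)) (x : config A d) :
  X `<=` closure (shift_orbit x) -> subsystem X Y -> Y x -> Y = X.
Proof.
move=> Xcl [YX _ cY iY] Yx; apply/seteqP; split=> // z /Xcl xz.
apply: cY; apply: closureS xz => _ [u _ <-].
by apply: (iY u); exists x.
Qed.

Lemma maximal_subsystem_unique (A : {fset int}) (d : nat)
    (X Y Z : set (config A d)) :
  transitive_shift X -> maximal_subsystem X Y -> maximal_subsystem X Z -> Y = Z.
Proof.
move=> [x Xx Xcl] [[sY nY] mY] [[sZ nZ] mZ].
have [XU|nU] := pselect (Y `|` Z = X).
  have : (Y `|` Z) x by rewrite XU.
  by case=> /(subsystem_dense_orbit _ _ _ _ _ Xcl) e;
    [case: nY|case: nZ]; apply: e.
(* If the union is proper, maximality of [Y] and of [Z] collapses it onto each of them, so they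
   agree. *)
have pU : proper_subsystem X (Y `|` Z) by split=> //; apply: subsystemU.
by rewrite -(mY _ pU (@subsetUl _ _ _)) (mZ _ pU (@subsetUr _ _ _)).
Qed.

Theorem theorem4p2 (A : {fset int}) (d : nat) (hd : (1 <= d)%N)
  (X : set (config A d)) (hX : is_shift X) (htrans : transitive_shift X) :
  has_maximality_type X 0 \/ has_maximality_type X 1.
Proof.
rewrite /has_maximality_type.
have [[Y mY]|noY] := pselect (exists Y, maximal_subsystem X Y).
  (* Once some maximal [Y] exists, uniqueness leaves a singleton, so the type is 1. *)
  right; have -> : [set Z | maximal_subsystem X Z] = [set Y].
    apply/seteqP; split=> [Z mZ|_ ->] //=.
    exact: maximal_subsystem_unique htrans mZ mY.
  exact: card_set1.
(* Type 0 amounts to emptiness of the set of maximal subsystems, as [I_0] is empty. *)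
left; rewrite II0 card_eq0; apply/eqP/seteqP; split=> // Y mY.
by apply: noY; exists Y.
Qed.
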